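(* Let $\mathcal{I}$ be an ideal on $\omega$, let $\boldsymbol{a}\in\mathbb{Z}^\omega$ be an integer sequence, and let $1\le\alpha<\omega_1$ be a countable ordinal. Then the following hold: (i) if $\mathcal{I}$ is a Farah ideal (in particular, if $\mathcal{I}$ is $F_\sigma$ or an analytic $P$-ideal), then $\mathsf{H}_{\boldsymbol{a}}(\mathcal{I})$ is an $F_{\sigma\delta}$ subgroup of $\mathbb{T}$; (ii) if $\mathcal{I}$ is a $\Pi^0_\alpha$ ideal, then $\mathsf{H}_{\boldsymbol{a}}(\mathcal{I})$ is a $\Pi^0_{\alpha+1}$ subgroup of $\mathbb{T}$; (iii) if $\mathcal{I}$ is a $\Sigma^0_\alpha$ ideal, then $\mathsf{H}_{\boldsymbol{a}}(\mathcal{I})$ is a $\Pi^0_{\alpha+2}$ subgroup of $\mathbb{T}$; (iv) if $\mathcal{I}$ is Borel [respectively analytic, co-analytic], then $\mathsf{H}_{\boldsymbol{a}}(\mathcal{I})$ is a Borel [respectively analytic, co-analytic] subgroup of $\mathbb{T}$; (v) if $\mathcal{I}$ is an analytic ideal, then $\mathsf{H}^\star_{\boldsymbol{a}}(\mathcal{I})$ is an analytic subgroup of $\mathbb{T}$.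
   Context: $\omega=\{0,1,2,\dots\}$, and each $n\in\omega$ is identified with $\{0,\dots,n-1\}$; $\mathbb{T}=\mathbb{R}/\mathbb{Z}$ with its usual compact Polish group topology; $\|x\|:=\min\{|x-z|:z\in\mathbb{Z}\}$. An ideal on $\omega$ is a family $\mathcal{I}\subseteq\mathcal{P}(\omega)$ closed under subsets and finite unions, containing all finite subsets of $\omega$, and with $\omega\notin\mathcal{I}$. $\mathcal{P}(\omega)$ is identified with the Cantor space $2^\omega$, and topological complexity of an ideal refers to this topology. $\mathcal{I}$ is a $P$-ideal if for every sequence $(S_n:n\in\omega)$ in $\mathcal{I}$ there is $S\in\mathcal{I}$ with $S_n\setminus S$ finite for all $n$. A family $\mathcal{F}\subseteq\mathcal{P}(\omega)$ is hereditary if $A\subseteq B\in\mathcal{F}$ implies $A\in\mathcal{F}$. $\mathcal{I}$ is a Farah ideal if there is a sequence $(C_i:i\in\omega)$ of hereditary compact subsets of $\mathcal{P}(\omega)$ such that $\mathcal{I}=\bigcap_{i\in\omega}\bigcup_{n\in\omega}\{A\subseteq\omega:A\setminus n\in C_i\}$. A sequence $(x_n)$ in $\mathbb{T}$ is $\mathcal{I}$-convergent to $\eta$ if $\{n\in\omega:\|x_n-\eta\|\ge\varepsilon\}\in\mathcal{I}$ for all $\varepsilon>0$; it is $\mathcal{I}^\star$-convergent to $\eta$ if there is $S\in\mathcal{I}$ such that $(x_n:n\in\omega\setminus S)$ converges to $\eta$ in the ordinary sense. For $\boldsymbol{a}=(a_n:n\in\omega)\in\mathbb{Z}^\omega$,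 $\mathsf{H}_{\boldsymbol{a}}(\mathcal{I}):=\{x\in\mathbb{T}:\mathcal{I}\text{-}\lim_n a_nx=0\}$ and $\mathsf{H}^\star_{\boldsymbol{a}}(\mathcal{I}):=\{x\in\mathbb{T}:\mathcal{I}^\star\text{-}\lim_n a_nx=0\}$. *)

(* Defs.v *)
From HB Require Import structures.
From mathcomp Require Import all_boot all_order all_algebra.
From mathcomp Require Import all_classical all_reals all_analysis.
From mathcomp Require Import wochoice borel_hierarchy.

Set Implicit Arguments.
Unset Strict Implicit.
Unset Printing Implicit Defensive.

Import Order.TTheory GRing.Theory Num.Theory.
Import numFieldNormedType.Exports.

Local Open Scope classical_set_scope.

(* ω₁ is realised as the initial segment, in a well-ordering of the uncountable
   type [set nat], of the points with countably many predecessors. The lemmas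
   [omega1_least], [omega1_countable_seg] and [omega1_uncountable] characterise
   it up to isomorphism: an uncountable well-order all of whose proper initial
   segments are countable. *)

Definition wo_natsets : rel (set nat) :=
  sval (well_ordering_principle (set nat)).

Lemma wo_natsets_well_order : well_order wo_natsets.
Proof. exact: svalP (well_ordering_principle (set nat)). Qed.

Local Lemma wo_chainT : wo_chain wo_natsets predT.
Proof. by move=> A _; exact: wo_natsets_well_order. Qed.

Lemma wo_natsets_least (A : set (set nat)) : A !=set0 ->
  exists2 m, A m & forall y, A y -> wo_natsets m y.
Proof.
move=> [x Ax]; have [|m [[/asboolP Am mle] _]] :=
  @wo_natsets_well_order [pred y | `[< A y >]].
  by exists x; apply/asboolP.
by exists m => // y Ay; apply: mle; apply/asboolP.
Qed.

Lemma wo_natsets_refl : reflexive wo_natsets.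
Proof. by move=> x; apply: (wo_chain_reflexive wo_chainT). Qed.

Lemma wo_natsets_total : total wo_natsets.
Proof. by move=> x y; apply: (wo_chainW wo_chainT). Qed.

Lemma wo_natsets_anti : antisymmetric wo_natsets.
Proof. by move=> x y; apply: (wo_chain_antisymmetric wo_chainT). Qed.

Lemma wo_natsets_trans : transitive wo_natsets.
Proof.
move=> y x z xy yz.
have [|m mP mle] := @wo_natsets_least [set x; y; z]; first by exists x; left; left.
have mx : wo_natsets m x by apply: mle; left; left.
have my : wo_natsets m y by apply: mle; left; right.
have mz : wo_natsets m z by apply: mle; right.
case: mP => [[|]|] /= E; first by rewrite -E.
  by rewrite (_ : x = y) //; apply: wo_natsets_anti; rewrite xy -E.
have <- : y = z by apply: wo_natsets_anti; rewrite yz -E.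
by [].
Qed.

Definition omega1 : Type :=
  {x : set nat | countable [set y | wo_natsets y x]}.

HB.instance Definition _ := [isSub of omega1 for @sval _ _].
HB.instance Definition _ := [Choice of omega1 by <:].

Definition omega1_le : rel omega1 := fun x y => wo_natsets (val x) (val y).

Lemma omega1_le_refl : reflexive omega1_le.
Proof. by move=> x; exact: wo_natsets_refl. Qed.

Lemma omega1_le_anti : antisymmetric omega1_le.
Proof. by move=> x y /wo_natsets_anti/val_inj. Qed.

Lemma omega1_le_trans : transitive omega1_le.
Proof. by move=> y x z; exact: wo_natsets_trans. Qed.

Lemma omega1_le_total : total omega1_le.
Proof. by move=> x y; exact: wo_natsets_total. Qed.

HB.instance Definition _ := Order.Le_isPOrder.Build
  Order.default_display omega1 omega1_le_refl omega1_le_anti omega1_le_trans.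
HB.instance Definition _ :=
  Order.POrder_isTotal.Build Order.default_display omega1 omega1_le_total.

Lemma omega1_least (A : set omega1) : A !=set0 ->
  exists2 m, A m & forall x, A x -> (m <= x)%O.
Proof.
move=> [x Ax]; have [|_ [m Am <-] mle] := @wo_natsets_least (val @` A).
  by exists (val x), x.
by exists m => // y Ay; apply: mle; exists y.
Qed.

Lemma omega1_countable_seg (a : omega1) : countable [set x | (x <= a)%O].
Proof.
have /countable_injP[f finj] := valP a.
apply/countable_injP; exists (f \o val) => x y.
rewrite !inE => xa ya /finj/val_inj; apply; rewrite inE //; exact: val_inj.
Qed.

Lemma set_nat_uncountable : ~ countable [set: set nat].
Proof.
move=> /countable_injP[f finj]; pose D : set nat := f @` [set A | ~ A (f A)].
have [fD|nfD] := pselect (D (f D)); last by apply: (nfD); exists D.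
by case: (fD) => A nA /finj AD; apply: nA; rewrite AD // inE.
Qed.

Lemma countable_seg_proper (C : set (set nat)) : countable C ->
  exists2 y, ~ C y & [set z | wo_natsets z y] `<=` C `|` [set y].
Proof.
move=> cC; have [|y yC ymin] := @wo_natsets_least (~` C).
  apply/set0P/negP => /eqP C0; apply: set_nat_uncountable.
  by rewrite -(setCK C) C0 setC0 in cC.
exists y => // z zy; have [|nCz] := pselect (C z); [by left|right].
by apply: wo_natsets_anti; rewrite zy ymin.
Qed.

Lemma omega1_uncountable : ~ countable [set: omega1].
Proof.
move=> c1; have cC : countable (val @` [set: omega1]).
  exact: sub_countable (card_image_le _ _) c1.
have [y nCy ysub] := countable_seg_proper cC.
have cy : countable [set z | wo_natsets z y].
  apply: sub_countable (subset_card_le ysub) _; rewrite -bigcup2E.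
  by apply: bigcup_countable => // -[|[|i]] _ //=.
by apply: nCy; exists (exist _ y cy).
Qed.

Lemma omega1_nomax (a : omega1) : exists b : omega1, (a < b)%O.
Proof.
apply: contrapT => nb; apply: omega1_uncountable.
apply: sub_countable (omega1_countable_seg a); apply: subset_card_le => x _ /=.
by rewrite leNgt; apply/negP => ax; apply: nb; exists x.
Qed.

Lemma omega1_nonempty : [set: omega1] !=set0.
Proof.
by apply/set0P/negP => /eqP E; apply: omega1_uncountable; rewrite E.
Qed.

Definition omega1_zero : omega1 := sval (cid2 (omega1_least omega1_nonempty)).

Lemma omega1_zero_le (a : omega1) : (omega1_zero <= a)%O.
Proof. exact: (s2valP' (cid2 (omega1_least omega1_nonempty))). Qed.

Definition omega1_succ (a : omega1) : omega1 :=
  sval (cid2 (@omega1_least [set b | (a < b)%O] (omega1_nomax a))).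

Lemma omega1_lt_succ (a : omega1) : (a < omega1_succ a)%O.
Proof. exact: (s2valP (cid2 (omega1_least (omega1_nomax a)))). Qed.

Lemma omega1_succ_le (a b : omega1) : (a < b)%O -> (omega1_succ a <= b)%O.
Proof. exact: (s2valP' (cid2 (omega1_least (omega1_nomax a)))). Qed.

Definition omega1_one : omega1 := omega1_succ omega1_zero.

(* The Borel hierarchy of a (metrizable) space: a set is Σ⁰_1 when it is open,
   and Σ⁰_α, 1 < α < ω₁, when it is a countable union of sets that are each
   Π⁰_β for some 1 ≤ β < α (the β may vary); Π⁰_α sets are the complements of
   Σ⁰_α sets. *)

Inductive Sigma0 (T : topologicalType) : omega1 -> set T -> Prop :=
| Sigma0_open (A : set T) : open A -> Sigma0 omega1_one A
| Sigma0_bigcup (alpha : omega1) (beta : nat -> omega1) (A : nat -> set T) :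
    (omega1_one < alpha)%O ->
    (forall n, (omega1_one <= beta n < alpha)%O) ->
    (forall n, Sigma0 (beta n) (~` A n)) ->
    Sigma0 alpha (\bigcup_n A n).

Definition Pi0 (T : topologicalType) (alpha : omega1) (A : set T) : Prop :=
  Sigma0 alpha (~` A).

Definition Fsigmadelta (T : topologicalType) (A : set T) : Prop :=
  exists2 F : nat -> set T, (forall n, Fsigma (F n)) & A = \bigcap_n F n.

Definition Borel (T : topologicalType) : set (set T) := <<s @open T >>.

Definition Baire_space : Type := prod_topology (fun _ : nat => nat).
HB.instance Definition _ := Topological.on Baire_space.

Definition analytic (T : topologicalType) (A : set T) : Prop :=
  A = set0 \/ exists2 f : Baire_space -> T, continuous f & A = range f.

Definition coanalytic (T : topologicalType) (A : set T) : Prop :=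
  analytic (~` A).

(* The family [F] of subsets of ω as a subset of 2^ω: topological notions about
   [F] are those of [in_cantor F]. *)
Definition in_cantor (F : set (set nat)) : set cantor_space :=
  [set b : cantor_space | F [set n | b n]].

Definition hereditary (F : set (set nat)) : Prop :=
  forall A B : set nat, A `<=` B -> F B -> F A.

Record is_ideal (I : set (set nat)) : Prop := {
  ideal_hereditary : hereditary I;
  ideal_setU : forall A B, I A -> I B -> I (A `|` B);
  ideal_finite : forall A, finite_set A -> I A;
  ideal_setT : ~ I setT }.

Definition P_ideal (I : set (set nat)) : Prop :=
  forall S : nat -> set nat, (forall n, I (S n)) ->
    exists2 S', I S' & forall n, finite_set (S n `\` S').

Definition Farah (I : set (set nat)) : Prop :=
  exists2 C : nat -> set (set nat),
    (forall i, hereditary (C i) /\ compact (in_cantor (C i))) &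
    I = \bigcap_i \bigcup_n [set A | C i (A `\` `I_n)].

Local Open Scope ring_scope.

Definition integers (R : realType) : zmodClosed R :=
  GRing.ZmodClosed.clone R Num.int_num_subdef _.

Definition circle (R : realType) : Type := {ideal_quot (integers R)}.

HB.instance Definition _ (R : realType) := GRing.Zmodule.on (circle R).
HB.instance Definition _ (R : realType) := Quotient.on (circle R).

Section circle_topology.
Local Open Scope quotient_scope.
Variable R : realType.

(* Not a copy of [quotient_topology (circle R)], whose [choiceType] structure is
   not the one underlying the group structure. *)
Let circle_open (U : set (circle R)) : Prop := open (\pi_(circle R) @^-1` U).

Let circle_openT : circle_open setT.
Proof. by rewrite /circle_open preimage_setT; exact: openT. Qed.

Let circle_openI (U V : set (circle R)) :
  circle_open U -> circle_open V -> circle_open (U `&` V).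
Proof. exact: openI. Qed.

Let circle_open_bigU (I : Type) (f : I -> set (circle R)) :
  (forall i, circle_open (f i)) -> circle_open (\bigcup_i f i).
Proof. by move=> fo; apply: bigcup_open => i _; exact: fo. Qed.

HB.instance Definition _ := isOpenTopological.Build (circle R)
  circle_openT circle_openI circle_open_bigU.

Lemma circle_openE (U : set (circle R)) :
  open U = open (\pi_(circle R) @^-1` U).
Proof. by []. Qed.

Lemma circle_pi_eq (x y : R) :
  \pi_(circle R) x = \pi_(circle R) y <-> exists z : int, x - y = z%:~R.
Proof.
have E : (x - y \is a Num.int) = (x == y %[mod circle R]).
  exact: (Quotient.idealrBE (integers R)).
by split=> [/eqP|xy]; [|apply/eqP]; rewrite -E; [move/intrP|apply/intrP].
Qed.

End circle_topology.

(* ‖x‖; the infimum is attained, see [dist_int_min]. *)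
Definition dist_int (R : realType) (x : R) : R :=
  inf [set `|x - z%:~R| | z in [set: int]].

Lemma dist_int_min (R : realType) (x : R) :
  exists z : int, dist_int x = `|x - z%:~R|
    /\ forall z' : int, `|x - z%:~R| <= `|x - z'%:~R|.
Proof.
suff [z zmin] : exists z : int, forall z' : int, `|x - z%:~R| <= `|x - z'%:~R|.
  exists z; split => //; apply/eqP; rewrite eq_le; apply/andP; split.
    by apply: ge_inf; [exists 0 => _ [t _ <-]|exists z].
  by apply: lb_le_inf; [exists `|x - z%:~R|, z|move=> _ [t _ <-]].
have fl := floor_le x; have lt := floorD1_gt x.
have far (t : int) : x - (Num.floor x)%:~R <= `|x - t%:~R| \/
    (Num.floor x + 1)%:~R - x <= `|x - t%:~R|.
  have [tf|ft] := leP t (Num.floor x); [left|right].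
    by rewrite (le_trans _ (ler_norm _))// lerB// ler_int.
  rewrite distrC (le_trans _ (ler_norm _))// lerB// ler_int.
  by rewrite -lezD1 in ft.
have ef : `|x - (Num.floor x)%:~R| = x - (Num.floor x)%:~R by rewrite ger0_norm ?subr_ge0.
have ec : `|x - (Num.floor x + 1)%:~R| = (Num.floor x + 1)%:~R - x.
  by rewrite distrC ger0_norm// subr_ge0 ltW.
have [fc|cf] := leP (x - (Num.floor x)%:~R) ((Num.floor x + 1)%:~R - x).
  exists (Num.floor x) => t; rewrite ef; have [//|] := far t.
  exact: le_trans.
exists (Num.floor x + 1) => t; rewrite ec; have [|//] := far t.
exact/le_trans/ltW.
Qed.

Definition circle_norm (R : realType) (x : circle R) : R := dist_int (repr x).

Lemma circle_norm_pi (R : realType) (x : R) :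
  circle_norm (\pi_(circle R)%qT x) = dist_int x.
Proof.
have /circle_pi_eq[z zE] : \pi_(circle R)%qT (repr (\pi_(circle R)%qT x)) =
    \pi_(circle R)%qT x by rewrite reprK.
rewrite /circle_norm /dist_int; congr inf; rewrite -(subrK x (repr _)) zE.
apply/seteqP; split=> _ [t _ <-].
  by exists (t - z) => //; rewrite intrB opprB addrCA addrA.
by exists (t + z) => //; rewrite [t + z]addrC intrD [z%:~R + x]addrC addrKA.
Qed.

Definition ideal_cvg (R : realType) (I : set (set nat)) (x : nat -> circle R)
    (eta : circle R) : Prop :=
  forall e : R, 0 < e -> I [set n | e <= circle_norm (x n - eta)].

Definition ideal_star_cvg (R : realType) (I : set (set nat))
    (x : nat -> circle R) (eta : circle R) : Prop :=
  exists2 S : set nat, I S & x @ within (~` S) \oo --> eta.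

Definition Hset (R : realType) (a : nat -> int) (I : set (set nat)) :
    set (circle R) :=
  [set x | ideal_cvg I (fun n => x *~ a n) 0].

Definition Hset_star (R : realType) (a : nat -> int) (I : set (set nat)) :
    set (circle R) :=
  [set x | ideal_star_cvg I (fun n => x *~ a n) 0].

Arguments Hset R a I : clear implicits.
Arguments Hset_star R a I : clear implicits.

Definition subgroup (G : zmodType) (A : set G) : Prop := zmod_closed [in A].

(* Main.v *)
Require Import Defs.
From HB Require Import structures.
From mathcomp Require Import all_boot all_order all_algebra.
From mathcomp Require Import all_classical all_reals all_analysis.
From mathcomp Require Import wochoice borel_hierarchy lra.

(** Let [g n x] be the norm of [x *~ a n], a continuous function of [x].

    By heredity of [I], [Hset R a I] is the intersection over [k] of the
    preimages of [I] under the level maps sending [x] to the set of the [n] with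
    [k.+1%:R^-1 <= g n x] ([Hset_bigcap_level]). A level map need not be
    continuous, but open sets pull back to [Fsigma] sets ([level_preimage_open]), so it
    raises Borel levels by at most one ([Sigma0_preimage]). This gives the
    estimates for ideals in the Borel hierarchy and for Borel ideals. For a Farah
    ideal one does better: if the family [C] is hereditary and closed then the
    points whose strict level set, deprived of its elements below [m], lies in [C]
    form a closed set ([closed_hereditary_level]), so [Hset R a I] is a countable
    intersection of [Fsigma] sets.

    In the analytic and coanalytic cases no preimage under a Borel map is needed:
    heredity lets one replace the level sets by an existentially quantified
    larger set in [I] (or smaller set outside [I]), and the relation between the
    point and these witnesses is closed. Points of the circle and witnesses are
    all coded in one point of the Baire space, whose closed subsets are retracts
    of it ([baire_closed_retract]), so that continuous images of closed sets of
    codes are analytic ([analytic_image_closed]). The same coding, with a modulus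
    of convergence as an additional witness, handles [Hset_star R a I].

    It remains to see that the ideals in question are Farah. For an [Fsigma] ideal
    see [Fsigma_Farah]. For an analytic P-ideal, the range of a continuous [f] on
    the Baire space, call a finite sequence [s] good when the sets coded by the
    extensions of [s] are cofinal in [I] under inclusion modulo finite sets. As
    [I] is directed under this relation for countable families, every good [s]
    has cofinally many extensions all of whose prefixes are good
    ([good_branch]). The sets whose initial segments are covered by sets with
    such codes form a compact family [C s], and every member of [I] has a final
    segment in each [C s]. Conversely, if [B] has a final segment in each [C s],
    two codes with good prefixes are built alternately so that each covers [B] on
    the gaps left by the other; thus [B] is, up to a finite set, contained in
    the union of two members of [I] ([C_sub]). *)

Set Implicit Arguments.
Unset Strict Implicit.
Unset Printing Implicit Defensive.

Import Order.TTheory GRing.Theory Num.Theory.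
Import numFieldNormedType.Exports.

Local Open Scope classical_set_scope.

(** * Sequence spaces and analytic sets *)

Definition agree (T : Type) (k : nat) (x y : nat -> T) : Prop :=
  forall i, (i < k)%N -> x i = y i.

Lemma agreeW (T : Type) (k l : nat) (x y : nat -> T) :
  (k <= l)%N -> agree l x y -> agree k x y.
Proof. by move=> kl xy i ik; apply: xy; exact: leq_trans kl. Qed.

Lemma agree_trans (T : Type) (k : nat) (y x z : nat -> T) :
  agree k x y -> agree k y z -> agree k x z.
Proof. by move=> xy yz i ik; rewrite xy ?yz. Qed.

Lemma agree_sym (T : Type) (k : nat) (x y : nat -> T) :
  agree k x y -> agree k y x.
Proof. by move=> xy i ik; rewrite xy. Qed.

Section sequence_space.
Variable K : discreteTopologicalType.
Let S := prod_topology (fun _ : nat => K).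

(** What turns topological questions on the Baire and Cantor spaces into
    questions on finite prefixes. *)
Lemma nbhs_agree (x : S) (U : set S) :
  nbhs x U <-> exists k, forall y : S, agree k x y -> U y.
Proof.
split; last first.
  move=> [k kU]; apply: (@filterS S (nbhs x) _ [set y : S | agree k x y]) => //.
  elim: k {kU} => [|k IHk]; first by apply: (@filterE S).
  have xk : nbhs x [set y : S | x k = y k].
    have : nbhs (x k) [set z | x k = z].
      rewrite (_ : [set z | _] = [set x k]); first exact: discrete_set1.
      by apply/seteqP; split=> z.
    exact: (@proj_continuous nat (fun _ => K) k x).
  apply: (@filterS S) (filterI IHk xk) => y [yk xyk] i.
  by rewrite ltnS leq_eqVlt => /predU1P[->//|]; exact: yk.
(* Convergence for a supremum topology is coordinatewise, so the filter of
   prefix sets converges to [x], hence contains every neighbourhood of [x]. *)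
pose F : set_system S :=
  filter_from [set: nat] (fun k => [set y : S | agree k x y]).
have FF : Filter F.
  apply: filter_from_filter; first by exists 0%N.
  move=> i j _ _; exists (maxn i j) => // y xy.
  by split; apply: agreeW xy; rewrite (leq_maxl, leq_maxr).
have : F --> x.
  apply/cvg_sup => i A /=.
  move=> [B [[C _ <-] /= Cx] CA].
  by exists i.+1 => // y /= xy; apply: CA; rewrite /= -xy.
by move=> /(_ U) FU /FU[k _ kU]; exists k.
Qed.

Lemma closed_agree (F : set S) :
  closed F <-> forall x, (forall k, exists2 y, F y & agree k x y) -> F x.
Proof.
split=> [cF x Fx|Fcl x clx]; last first.
  apply: Fcl => k; have [|y [Fy xy]] := clx [set y : S | agree k x y].
    by apply/nbhs_agree; exists k.
  by exists y.
apply: cF => U /nbhs_agree[k kU]; have [y Fy xy] := Fx k.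
by exists y; split => //; exact: kU.
Qed.

Lemma open_agree (U : set S) :
  open U <-> forall x, U x -> exists k, forall y : S, agree k x y -> U y.
Proof.
rewrite openE; split=> [oU x /oU /nbhs_agree //|oU x Ux].
by apply/nbhs_agree; exact: oU.
Qed.

Lemma clopen_coordinate (n : nat) (P : set K) : clopen [set x : S | P (x n)].
Proof.
split; [apply/open_agree => x Px|apply/closed_agree => x /(_ n.+1)[y Py xy]].
  by exists n.+1 => y xy /=; rewrite -xy.
by rewrite /= xy.
Qed.

Lemma continuous_agree (T : topologicalType) (f : T -> S) :
  continuous f <-> forall x k, \forall y \near x, agree k (f x) (f y).
Proof.
split=> [cf x k|cf x U /nbhs_agree[k kU]]; last first.
  by apply: filterS (cf x k) => y; exact: kU.
by apply: cf; apply/nbhs_agree; exists k.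
Qed.

End sequence_space.

Lemma baire_continuousP (T : topologicalType) (f : Baire_space -> T) :
  continuous f <-> forall x U, open U -> U (f x) ->
    exists k, forall y, agree k x y -> U (f y).
Proof.
split=> [cf x U oU Ufx|cf x V].
  by apply/nbhs_agree; apply: cf; exact: open_nbhs_nbhs.
rewrite nbhsE => -[U [oU Ufx] UV].
have [k kU] := cf x U oU Ufx; apply/nbhs_agree; exists k => y /kU; exact: UV.
Qed.

Lemma baire_modulus (f : Baire_space -> cantor_space) (x : Baire_space) (m : nat) :
  continuous f -> exists k, forall y, agree k x y -> agree m (f x) (f y).
Proof. by move=> /continuous_agree/(_ x m)/nbhs_agree. Qed.

Lemma agree_mkseq (T : Type) (k : nat) (x y : nat -> T) :
  agree k x y <-> mkseq x k = mkseq y k.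
Proof.
split=> [xy|xy i ik]; first by apply/eq_in_map => i; rewrite mem_iota => /xy.
by rewrite -(nth_mkseq (x 0%N) x ik) xy nth_mkseq.
Qed.

(** The retraction fixes [F]; a point [u] outside [F] has a longest prefix that
    still extends into [F] ([F] being closed), and goes to a point of [F] chosen
    as a function of that prefix alone. Continuity holds because the prefix, and
    so the image, is decided by finitely many terms of [u]. *)
Lemma baire_closed_retract (F : set Baire_space) : closed F -> F !=set0 ->
  exists2 r : Baire_space -> Baire_space, continuous r & range r = F.
Proof.
move=> /closed_agree Fcl [z Fz].
pose live (k : nat) (u : Baire_space) := exists2 y, F y & agree k u y.
have liveW k l u : (k <= l)%N -> live l u -> live k u.
  by move=> kl [y Fy uy]; exists y => //; exact: agreeW uy.
have live_agree k u v : agree k u v -> live k u -> live k v.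
  move=> uv [y Fy uy]; exists y => //.
  exact: agree_trans (agree_sym uv) uy.
have /choice[c cP] : forall s : seq nat, exists w : Baire_space,
    (exists2 y, F y & s = mkseq y (size s)) -> F w /\ s = mkseq w (size s).
  move=> s; have [[y Fy sy]|] := pselect (exists2 y, F y & s = mkseq y (size s)).
    by exists y.
  by exists z.
have {}cP k u : live k u -> F (c (mkseq u k)) /\ agree k u (c (mkseq u k)).
  move=> [y Fy /agree_mkseq uy]; have [|Fc] := cP (mkseq u k).
    by exists y; rewrite ?size_mkseq.
  by rewrite size_mkseq => /agree_mkseq.
have /choice[r rP] : forall u, exists v, F u /\ v = u \/
    exists n, [/\ live n u, ~ live n.+1 u & v = c (mkseq u n)].
  move=> u; have [Fu|nFu] := pselect (F u); first by exists u; left.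
  have exdead : exists k, `[< ~ live k u >].
    apply: contrapT => nd; apply/nFu/Fcl => k; apply: contrapT => nlk.
    by apply: nd; exists k; apply/asboolP.
  case: (ex_minnP exdead) => -[|n] /asboolP nl nmin.
    by exfalso; apply: nl; exists z.
  exists (c (mkseq u n)); right; exists n; split => //.
  apply: contrapT => nln; have := nmin n; rewrite ltnn => /implyP/=.
  by rewrite implybF => /asboolP.
have rF u : F (r u).
  by have [[Fu ->]//|[n [ln _ ->]]] := rP u; have [] := cP n u ln.
have rid u : F u -> r u = u.
  move=> Fu; have [[_ //]|[n [_ nl _]]] := rP u.
  by exfalso; apply: nl; exists u.
exists r; last first.
  apply/seteqP; split=> [_ [u _ <-] //|u Fu]; exists u => //; exact: rid.
apply/continuous_agree => u k; apply/nbhs_agree.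
have [[Fu ru]|[n [ln nln ru]]] := rP u; rewrite ru.
  exists k => v uv; have [[Fv ->]//|[n [ln nln ->]]] := rP v.
  have kn : (k <= n)%N.
    rewrite leqNgt; apply/negP => nk; apply: nln; apply: (liveW _ k) => //.
    by apply: live_agree uv _; exists u.
  apply: agree_trans uv _; have [_] := cP n v ln; exact: agreeW.
exists n.+1 => v uv; have [[Fv _]|[m [lm nlm ->]]] := rP v.
  by exfalso; apply: nln; exists v.
(* The length of the longest live prefix is the same for [u] and [v]. *)
have -> : m = n.
  apply/eqP; rewrite eqn_leq; apply/andP; split; rewrite leqNgt; apply/negP => mn.
    by apply: nln; apply: live_agree (agree_sym uv) _; exact: liveW lm.
  by apply: nlm; apply: (liveW _ n) => //; apply: live_agree (agreeW _ uv) ln.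
by rewrite (_ : mkseq v n = mkseq u n)//; apply/agree_mkseq/agree_sym; exact: agreeW uv.
Qed.

(** The way analyticity is proved below: it lets one exhibit a set as the image
    of the codes that satisfy a closed condition. *)
Lemma analytic_image_closed (T : topologicalType) (F : set Baire_space)
    (f : Baire_space -> T) : closed F -> continuous f -> analytic (f @` F).
Proof.
move=> Fcl cf; have [->|/set0P F0] := eqVneq F set0.
  by left; rewrite image_set0.
have [r cr rF] := baire_closed_retract Fcl F0.
right; exists (f \o r); last by rewrite -rF image_comp.
by move=> x; apply: continuous_comp; [exact: cr|exact: cf].
Qed.

(** A point of the Baire space codes countably many points of it, its rows,
    through the pairing function of [nat * nat]. *)
Definition row_of (z : Baire_space) (i : nat) : Baire_space :=
  fun j => z (pickle (i, j)).

Definition of_rows (y : nat -> Baire_space) : Baire_space :=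
  fun n => let ij := odflt (0%N, 0%N) (unpickle n) in y ij.1 ij.2.

Lemma of_rowsK (y : nat -> Baire_space) (i : nat) : row_of (of_rows y) i = y i.
Proof. by apply/funext => j; rewrite /row_of /of_rows pickleK. Qed.

Lemma row_of_continuous (i : nat) : continuous (row_of^~ i).
Proof.
apply/continuous_agree => z k; apply/nbhs_agree.
exists (\max_(j < k) pickle (i, val j)).+1 => y zy j jk; apply: zy.
rewrite ltnS.
exact: (@leq_bigmax _ (fun j : 'I_k => pickle (i, val j)) (Ordinal jk)).
Qed.

(** * The norm and the topology of the circle *)

Section circle_facts.
Local Open Scope ring_scope.
Local Open Scope quotient_scope.
Variable R : realType.
Implicit Types (x y : circle R) (r s : R).

Notation proj_circle := (\pi_(circle R) : R -> circle R).

Lemma proj_circle_continuous : continuous proj_circle.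
Proof. by apply/continuousP => U; rewrite circle_openE. Qed.

Lemma proj_circle0 : proj_circle 0 = 0.
Proof. exact: raddf0. Qed.

Lemma dist_int_le r (z : int) : dist_int r <= `|r - z%:~R|.
Proof. by have [t [-> ]] := dist_int_min r; exact. Qed.

Lemma dist_int_ge0 r : 0 <= dist_int r.
Proof. by have [z [-> _]] := dist_int_min r. Qed.

Lemma dist_intD r s : dist_int (r + s) <= dist_int r + dist_int s.
Proof.
have [t [-> _]] := dist_int_min r; have [u [-> _]] := dist_int_min s.
apply: le_trans (dist_int_le _ (t + u)) _.
by rewrite intrD opprD addrACA ler_normD.
Qed.

Lemma dist_intN r : dist_int (- r) = dist_int r.
Proof.
suff H s : dist_int (- s) <= dist_int s.
  by apply/eqP; rewrite eq_le H -{1}[r]opprK H.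
have [t [-> _]] := dist_int_min s; apply: le_trans (dist_int_le _ (- t)) _.
by rewrite rmorphN/= -opprB opprK addrC opprB distrC.
Qed.

Lemma dist_int_norm r : dist_int r <= `|r|.
Proof. by apply: le_trans (dist_int_le r 0) _; rewrite subr0. Qed.

(** Every class has a representative closest to 0; calculations with
    [circle_norm] then become calculations with absolute values. *)
Lemma circle_normP x : exists2 r, x = proj_circle r & circle_norm x = `|r|.
Proof.
have [z [rz _]] := dist_int_min (repr x).
exists (repr x - z%:~R); last exact: rz.
rewrite -[LHS]reprK; apply/circle_pi_eq; exists z.
by rewrite opprB addrC subrK.
Qed.

Lemma circle_normD x y : circle_norm (x + y) <= circle_norm x + circle_norm y.
Proof.
have [r -> ->] := circle_normP x; have [s -> ->] := circle_normP y.
rewrite -[_ + _]raddfD circle_norm_pi.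
exact: le_trans (dist_int_norm _) (ler_normD _ _).
Qed.

Lemma circle_normN x : circle_norm (- x) = circle_norm x.
Proof. by rewrite -[x]reprK -raddfN/= !circle_norm_pi dist_intN. Qed.

Lemma circle_norm0 : circle_norm (0 : circle R) = 0.
Proof.
apply/eqP; rewrite eq_le {2}/circle_norm dist_int_ge0 andbT.
by rewrite -proj_circle0 circle_norm_pi (le_trans (dist_int_norm _))// normr0.
Qed.

Lemma dist_int_continuous : continuous (@dist_int R).
Proof.
move=> r; apply/cvgrPdist_le => e e0; near=> s.
apply: (@le_trans _ _ `|r - s|); last by near: s; apply: cvgr_dist_le.
have key (u v : R) : dist_int u - dist_int v <= `|u - v|.
  have := dist_intD (u - v) v; rewrite subrK lerBlDr => /le_trans; apply.
  by rewrite lerD2r dist_int_norm.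
by rewrite ler_norml key andbT lerNl opprB distrC key.
Unshelve. all: by end_near. Qed.

Lemma circle_norm_mul_continuous (z : int) :
  continuous (fun x => circle_norm (x *~ z) : R).
Proof.
apply/continuousP => U oU; rewrite circle_openE.
rewrite (_ : _ @^-1` _ = (fun r => dist_int (r *~ z)) @^-1` U); last first.
  by apply/seteqP; split=> r /=; rewrite -raddfMz circle_norm_pi.
apply: open_comp oU => r _.
apply: (@continuous_comp _ _ _ (fun r : R => r *~ z) (@dist_int R)); last first.
  exact: dist_int_continuous.
rewrite (_ : (fun r : R => r *~ z) = (fun r => z%:~R * r)).
  exact: mulrl_continuous.
by apply/funext => u; rewrite mulrzl.
Qed.

(** The quotient topology is the one given by [circle_norm]; at 0 this is what
    turns ordinary convergence into inequalities. *)
Lemma nbhs_circle0 (U : set (circle R)) :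
  nbhs 0 U <-> exists2 e : R, 0 < e & forall x, circle_norm x < e -> U x.
Proof.
split=> [|[e e0 eU]].
  rewrite nbhsE => -[V [oV V0] VU].
  have : nbhs (0 : R) (proj_circle @^-1` V).
    by apply: proj_circle_continuous; rewrite proj_circle0; exact: open_nbhs_nbhs.
  move=> /nbhs_ballP[e/= e0 eV]; exists e => // x.
  have [r -> ->] := circle_normP x => re; apply/VU/(eV r).
  by rewrite /ball/= sub0r normrN.
apply: filterS eU _.
have /(_ 0) := @circle_norm_mul_continuous 1.
move=> /(_ [set r | r < e]) /=; apply.
by rewrite circle_norm0; exact: lt_nbhsl.
Qed.
End circle_facts.

(** * The circle as a continuous image of the Baire space *)

Section binary_expansion.
Local Open Scope ring_scope.
Local Open Scope quotient_scope.
Variable R : realType.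

Definition binary_trunc (u : Baire_space) (n : nat) : R :=
  \sum_(i < n | u i != 0%N) 2 ^- i.+1.

Definition binary (u : Baire_space) : R := sup (range (binary_trunc u)).

Lemma binary_truncS u n : binary_trunc u n.+1 =
  binary_trunc u n + (if u n != 0%N then 2 ^- n.+1 else 0).
Proof. by rewrite /binary_trunc big_mkcond big_ord_recr -big_mkcond. Qed.

Lemma binary_trunc_le u m n : binary_trunc u m <= binary_trunc u n + 2 ^- n.
Proof.
have up k : binary_trunc u k <= binary_trunc u k.+1.
  by rewrite binary_truncS lerDl; case: ifP.
have down k : binary_trunc u k.+1 + 2 ^- k.+1 <= binary_trunc u k + 2 ^- k.
  rewrite binary_truncS -addrA lerD2l [leRHS](splitr) exprS invfM mulrC lerD2r.
  by case: ifP.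
have [mn|/ltnW nm] := leqP m n.
  apply: (@le_trans _ _ (binary_trunc u n)); last by rewrite lerDl.
  exact: (homo_leq (@lexx _ _) (@le_trans _ _) up).
apply: (@le_trans _ _ (binary_trunc u m + 2 ^- m)); first by rewrite lerDl.
apply: (homo_leq (f := fun k => binary_trunc u k + 2 ^- k)
  (r := fun a b => b <= a)) nm => //.
by move=> y x z yx zy; exact: le_trans yx.
Qed.

Lemma binary_bounds u n :
  binary_trunc u n <= binary u <= binary_trunc u n + 2 ^- n.
Proof.
have ub : has_ubound (range (binary_trunc u)).
  by exists (binary_trunc u n + 2 ^- n) => _ [m _ <-]; exact: binary_trunc_le.
rewrite ub_le_sup//=; last by exists n.
apply: ge_sup; first by exists (binary_trunc u n), n.
by move=> _ [m _ <-]; exact: binary_trunc_le.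
Qed.

Lemma half_pow_lt (e : R) : 0 < e -> exists n, 2 ^- n < e.
Proof.
move=> e0; have [n] := ltr_add_invr e0; rewrite add0r => ne; exists n.
apply: le_lt_trans ne; rewrite lef_pV2 ?posrE ?exprn_gt0//.
by rewrite -natrX ler_nat ltn_expl.
Qed.

Lemma binary_continuous : continuous binary.
Proof.
apply/baire_continuousP => u U oU Uu.
have /nbhs_ballP[e/= e0 eU] : nbhs (binary u) U by exact: open_nbhs_nbhs.
have [n ne] := half_pow_lt e0; exists n => v uv; apply: eU.
have E : binary_trunc u n = binary_trunc v n.
  by apply: eq_big => [i|//]; rewrite (uv i).
have /andP[u1 u2] := binary_bounds u n; have /andP[v1 v2] := binary_bounds v n.
rewrite /ball/= (le_lt_trans _ ne)// ler_norml; rewrite E in u1 u2.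
by apply/andP; split; lra.
Qed.

(** The greedy binary expansion. *)
Lemma binary_surj (r : R) : 0 <= r <= 1 -> exists u, binary u = r.
Proof.
move=> /andP[r0 r1].
pose fix l n := if n is m.+1 then
  (if l m + 2 ^- m.+1 <= r then l m + 2 ^- m.+1 else l m) else 0.
pose u : Baire_space := fun n => (l n + 2 ^- n.+1 <= r : bool).
have lE n : binary_trunc u n = l n.
  elim: n => [|n IH]; first by rewrite /binary_trunc big_ord0.
  by rewrite binary_truncS IH /u eqb0 negbK /=; case: ifP; rewrite ?addr0.
have lr n : l n <= r <= l n + 2 ^- n.
  elim: n => [|n /andP[IH1 IH2]]; first by rewrite /= expr0 invr1 add0r r0.
  rewrite /=; case: (leP (l n + _) r) => [->|/ltW ->]; last by rewrite IH1.
  rewrite -addrA -mulr2n exprS invfM -mulrnAl -[2^-1 *+ 2]mulr_natl.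
  by rewrite divff ?mul1r.
exists u; apply/eqP; rewrite eq_le; apply/andP; split.
  apply/ler_addgt0Pr => e /half_pow_lt[n ne].
  have /andP[_ bn] := binary_bounds u n; have /andP[ln _] := lr n.
  by move: bn; rewrite lE; lra.
apply/ler_addgt0Pr => e /half_pow_lt[n ne].
have /andP[bn _] := binary_bounds u n; have /andP[_ ln] := lr n.
by move: bn; rewrite lE; lra.
Qed.

Definition circle_of_baire (u : Baire_space) : circle R :=
  \pi_(circle R) (binary u).

Lemma circle_of_baire_continuous : continuous circle_of_baire.
Proof.
move=> u; apply: (@continuous_comp _ _ _ binary (\pi_(circle R) : R -> circle R)).
  exact: binary_continuous.
exact: proj_circle_continuous.
Qed.

(** The unit interval meets every class. *)
Lemma circle_of_baire_surj (x : circle R) : exists u, circle_of_baire u = x.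
Proof.
have [|u uE] := @binary_surj (repr x - (Num.floor (repr x))%:~R).
  by rewrite subr_ge0 floor_le/= lerBlDl -(intrD _ _ 1) ltW// floorD1_gt.
exists u; rewrite /circle_of_baire uE -[RHS]reprK; apply/circle_pi_eq.
by exists (- Num.floor (repr x)); rewrite addrC addKr rmorphN.
Qed.
End binary_expansion.

(** * The Borel hierarchy along maps of the first Baire class *)

Lemma omega1_succ_mono (b c : omega1) :
  (b < c)%O -> (omega1_succ b < omega1_succ c)%O.
Proof. by move=> /omega1_succ_le/le_lt_trans; apply; exact: omega1_lt_succ. Qed.

Lemma Sigma0_inv (T : topologicalType) (alpha : omega1) (A : set T) :
  Sigma0 alpha A -> alpha = omega1_one /\ open A \/
  [/\ (omega1_one < alpha)%O & exists (beta : nat -> omega1) (B : nat -> set T),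
    [/\ forall n, (omega1_one <= beta n < alpha)%O,
        forall n, Sigma0 (beta n) (~` B n) & A = \bigcup_n B n]].
Proof.
by case=> [B oB|a b B a1 ba sB]; [left|right; split => //; exists b, B].
Qed.

Lemma bigcup_countType (J : countType) (j0 : J) (T : Type) (F : J -> set T) :
  \bigcup_j F j = \bigcup_n F (odflt j0 (unpickle n)).
Proof.
apply/seteqP; split=> x [i _ Fx]; first by exists (pickle i); rewrite ?pickleK.
by exists (odflt j0 (unpickle i)).
Qed.

Lemma Sigma0_bigcup_countType (J : countType) (j0 : J) (T : topologicalType)
    (alpha : omega1) (beta : J -> omega1) (F : J -> set T) :
  (omega1_one < alpha)%O -> (forall j, (omega1_one <= beta j < alpha)%O) ->
  (forall j, Sigma0 (beta j) (~` F j)) -> Sigma0 alpha (\bigcup_j F j).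
Proof.
move=> a1 ba sF; rewrite (bigcup_countType j0).
by apply: (@Sigma0_bigcup _ _ (fun n => beta (odflt j0 (unpickle n)))).
Qed.

Lemma Sigma0_bigcup_nat (T : topologicalType) (alpha : omega1)
    (A : nat -> set T) :
  (forall n, Sigma0 alpha (A n)) -> Sigma0 alpha (\bigcup_n A n).
Proof.
move=> sA; have [a1|a1] := eqVneq alpha omega1_one.
  rewrite a1; apply: Sigma0_open; apply: bigcup_open => n _.
  have [[_ //]|[]] := Sigma0_inv (sA n).
  by rewrite a1 ltxx.
have /choice[bB bBP] : forall n, exists bB : (nat -> omega1) * (nat -> set T),
    [/\ (omega1_one < alpha)%O, forall m, (omega1_one <= bB.1 m < alpha)%O,
        forall m, Sigma0 (bB.1 m) (~` bB.2 m) & A n = \bigcup_m bB.2 m].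
  move=> n; have [[/eqP]|[a2 [b [B [bb sB AE]]]]] := Sigma0_inv (sA n).
    by rewrite (negbTE a1).
  by exists (b, B).
have -> : \bigcup_n A n = \bigcup_(nm : nat * nat) (bB nm.1).2 nm.2.
  apply/seteqP; split=> x.
    by move=> [n _]; have [_ _ _ ->] := bBP n => -[m _ Bx]; exists (n, m).
  move=> [[n m] _ Bx]; exists n => //; have [_ _ _ ->] := bBP n.
  by exists m.
have [a2 _ _ _] := bBP 0%N.
apply: (@Sigma0_bigcup_countType _ (0%N, 0%N) _ _
  (fun nm : nat * nat => (bB nm.1).1 nm.2)) => //.
  by move=> [n m] /=; have [_ ->] := bBP n.
by move=> [n m] /=; have [_ _ sB _] := bBP n; exact: sB.
Qed.

Lemma Fsigma_Sigma0 (T : topologicalType) (A : set T) :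
  Fsigma A -> Sigma0 (omega1_succ omega1_one) A.
Proof.
move=> [F Fcl ->]; apply: (@Sigma0_bigcup _ _ (fun=> omega1_one)).
- exact: omega1_lt_succ.
- by move=> _; rewrite lexx omega1_lt_succ.
- by move=> n; apply: Sigma0_open; exact: closed_openC.
Qed.

(** A map of the first Baire class raises the level in the Borel hierarchy by at
    most one, by induction on the level: the base case is the hypothesis, and a
    union of complements at levels [beta n] pulls back to one of complements at
    levels [omega1_succ (beta n)], all below [omega1_succ alpha]. *)
Lemma Sigma0_preimage (S T : topologicalType) (f : S -> T) :
  (forall U, open U -> Fsigma (f @^-1` U)) ->
  forall alpha A, Sigma0 alpha A -> Sigma0 (omega1_succ alpha) (f @^-1` A).
Proof.
move=> fF alpha A; elim=> [U oU|a b B a1 ba _ IH].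
  by apply: Fsigma_Sigma0; exact: fF.
rewrite preimage_bigcup; apply: (@Sigma0_bigcup _ _ (fun n => omega1_succ (b n))).
- exact: lt_trans a1 (omega1_lt_succ _).
- move=> n; have /andP[b1 bn] := ba n.
  by rewrite (le_trans b1 (ltW (omega1_lt_succ _))) omega1_succ_mono.
- exact: IH.
Qed.

Lemma Borel_setC (T : topologicalType) (A : set T) : Borel A -> Borel (~` A).
Proof. by rewrite -setTD; exact: sigma_algebraCD. Qed.

Lemma Borel_bigcap (T : topologicalType) (A : nat -> set T) :
  (forall n, Borel (A n)) -> Borel (\bigcap_n A n).
Proof.
move=> bA; rewrite -[\bigcap_n _]setCK setC_bigcap; apply: Borel_setC.
by apply: sigma_algebra_bigcup => n; exact: Borel_setC.
Qed.

Lemma Fsigma_Borel (T : topologicalType) (A : set T) : Fsigma A -> Borel A.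
Proof.
move=> [F Fcl ->]; apply: sigma_algebra_bigcup => n; rewrite -[F n]setCK.
by apply: Borel_setC; apply: sub_sigma_algebra; exact: closed_openC.
Qed.

Lemma Borel_preimage (S T : topologicalType) (f : S -> T) :
  (forall U, open U -> Fsigma (f @^-1` U)) ->
  forall A, Borel A -> Borel (f @^-1` A).
Proof.
move=> fF A; apply: (@smallest_sub _ _ _ [set B | Borel (f @^-1` B)]).
  split=> [|B|B]; rewrite /= ?preimage_set0.
  - exact: sigma_algebra0.
  - by rewrite setTD preimage_setC; exact: Borel_setC.
  - by rewrite preimage_bigcup; exact: sigma_algebra_bigcup.
by move=> U /fF; exact: Fsigma_Borel.
Qed.

(** * Level sets of a sequence of continuous functions *)

Section level_sets.
Local Open Scope ring_scope.
Variables (R : realType) (T : topologicalType) (g : nat -> T -> R).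
Hypothesis g_continuous : forall n, continuous (g n).

Definition level (e : R) (x : T) : cantor_space := fun n => e <= g n x.

Lemma closed_level_ge n e : closed [set x | e <= g n x].
Proof.
apply: (@preimage_closed _ _ (g n) [set r | e <= r]).
  by move=> x _; exact: g_continuous.
exact: closed_ge.
Qed.

Lemma closed_level_le n e : closed [set x | g n x <= e].
Proof.
apply: (@preimage_closed _ _ (g n) [set r | r <= e]).
  by move=> x _; exact: g_continuous.
exact: closed_le.
Qed.

Lemma level_gap (e : R) (x : T) (k : nat) :
  exists j : nat, forall i, (i < k)%N -> g i x < e -> g i x <= e - j.+1%:R^-1.
Proof.
elim: k => [|k [j jk]]; first by exists 0%N.
have [ge|lt] := leP e (g k x).
  exists j => i; rewrite ltnS leq_eqVlt => /predU1P[->|]; last exact: jk.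
  by rewrite ltNge ge.
have [l kl] := ltr_add_invr lt; exists (maxn j l) => i.
rewrite ltnS leq_eqVlt => /predU1P[-> _|ik gie].
  rewrite lerBrDr (le_trans _ (ltW kl))// lerD2l lef_pV2 ?posrE// ler_nat ltnS.
  exact: leq_maxr.
apply: le_trans (jk i ik gie) _.
by rewrite lerD2l lerN2 lef_pV2 ?posrE// ler_nat ltnS leq_maxl.
Qed.

(** The level map need not be continuous, but it is of the first Baire class: each
    coordinate condition is closed or open, and open conditions on [g i] are
    increasing unions of closed ones. *)
Lemma level_preimage_open (e : R) (U : set cantor_space) :
  open U -> Fsigma (level e @^-1` U).
Proof.
move=> /open_agree oU.
pose inU (s : seq bool) :=
  `[< forall y : cantor_space, mkseq y (size s) = s -> U y >].
(* An open set is a countable union of cylinders, and the points whose level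
   set starts with [s] are a union of closed sets once the conditions
   [g i x < e] are weakened to [g i x <= e - j.+1%:R^-1] for some common [j]. *)
pose F (sj : seq bool * nat) : set T := if inU sj.1 then
  \bigcap_(i in `I_(size sj.1)) [set x | if nth false sj.1 i
     then e <= g i x else g i x <= e - sj.2.+1%:R^-1] else set0.
have Fcl sj : closed (F sj).
  rewrite /F; case: ifP => _; last exact: closed0.
  apply: closed_bigI => i _; case: (nth _ _ _).
    exact: closed_level_ge.
  exact: closed_level_le.
have -> : level e @^-1` U = \bigcup_sj F sj.
  apply/seteqP; split=> x /=.
    move=> /oU[k kU]; have [j jk] := level_gap e x k.
    exists (mkseq (level e x) k, j) => //; rewrite /F /= ifT.
      move=> i /=; rewrite size_mkseq => ik; rewrite nth_mkseq//.
      by rewrite /level; case: leP => // /(jk i ik).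
    apply/asboolP => y; rewrite size_mkseq => /agree_mkseq ye.
    by apply: kU; exact: agree_sym.
  move=> [[s j] _]; rewrite /F /=; case: ifP => // /asboolP sU xs.
  apply: sU; apply: (@eq_from_nth _ false); rewrite size_mkseq// => i ik.
  rewrite nth_mkseq//; have := xs i ik; rewrite /level /=; case: ifP => [_ ->//|_].
  move=> gie; apply/negbTE; rewrite -ltNge (le_lt_trans gie)//.
  by rewrite ltrBlDr ltrDl invr_gt0.
rewrite (@bigcup_countType (seq bool * nat)%type ([::], 0%N)).
by exists (fun n => F (odflt ([::], 0%N) (unpickle n))).
Qed.

End level_sets.

(** * Compact families of sets and Farah ideals: the case of [Fsigma] ideals *)

Definition char_seq (A : set nat) : cantor_space := fun n => `[< A n >].

Lemma char_seqK (A : set nat) : [set n | char_seq A n] = A.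
Proof. by apply/seteqP; split=> n /asboolP. Qed.

Lemma cantor_compact_closed (F : set cantor_space) : compact F <-> closed F.
Proof.
split=> [|Fcl]; first by apply: compact_closed; exact: cantor_space_hausdorff.
by apply: subclosed_compact cantor_space_compact _.
Qed.

Lemma cantor_clopen_coordinate (n : nat) : clopen [set b : cantor_space | b n].
Proof. exact: (@clopen_coordinate bool n (fun b => b)). Qed.

(** The downward closure is the projection of a closed, hence compact, subset of
    the square of the Cantor space. *)
Lemma closed_downward (F : set cantor_space) : closed F ->
  closed [set c : cantor_space | exists2 b, F b & forall i, c i -> b i].
Proof.
move=> Fcl; pose G : set (cantor_space * cantor_space) :=
  [set cb : cantor_space * cantor_space | F cb.2 /\ forall i, cb.1 i -> cb.2 i].
have -> : [set c : cantor_space | exists2 b, F b & forall i, c i -> b i] =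
    fst @` G.
  apply/seteqP; split=> [c [b Fb cb]|_ [[c b] [Fb cb] <-]].
    by exists (c, b).
  by exists b.
apply/cantor_compact_closed; apply: continuous_compact.
  by apply: continuous_subspaceT => x; exact: cvg_fst.
apply: (@subclosed_compact _ _
  ([set: cantor_space] `*` [set: cantor_space])) => //.
  have -> : G = snd @^-1` F `&` \bigcap_i
      (fst @^-1` (~` [set c : cantor_space | c i]) `|`
       snd @^-1` [set b : cantor_space | b i]).
    apply/seteqP; split=> [[c b] [Fb cb]|[c b] [Fb cb]]; split=> // i.
      by move=> _; have [/cb|] := boolP (c i); [right|left; apply/negP].
    by move=> ci; have [|] := cb i Logic.I.
  have fc : continuous (@fst cantor_space cantor_space).
    by move=> x; exact: cvg_fst.
  have sc : continuous (@snd cantor_space cantor_space).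
    by move=> x; exact: cvg_snd.
  apply: closedI; first exact: (@preimage_closed _ _ _ F (fun x _ => sc x)).
  apply: closed_bigI => i _; have [op cl] := cantor_clopen_coordinate i.
  apply: closedU.
    apply: (@preimage_closed _ _ _ _ (fun x _ => fc x)).
    exact/open_closedC/op.
  exact: (@preimage_closed _ _ _ _ (fun x _ => sc x)).
by apply: compact_setX; exact: cantor_space_compact.
Qed.

Lemma analytic_ideal_range (I : set (set nat)) : is_ideal I ->
  analytic (in_cantor I) ->
  exists2 f : Baire_space -> cantor_space, continuous f & in_cantor I = range f.
Proof.
move=> I_ideal [I0|//]; have : in_cantor I (char_seq set0).
  rewrite /in_cantor /= char_seqK.
  exact: (ideal_finite I_ideal (finite_set0 nat)).
by rewrite I0.
Qed.

(** An [Fsigma] ideal is an increasing union of hereditary compact families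
    [K n]. The single compact family of the sets [A] that lie in [K m] for
    every [m] in [A] witnesses the Farah property: if [A] is in [K n] then the
    part of [A] above [n] only has elements [m >= n], so it lies in the family;
    conversely a nonempty member of the family lies in some [K m]. *)
Lemma Fsigma_Farah (I : set (set nat)) :
  is_ideal I -> Fsigma (in_cantor I) -> Farah I.
Proof.
move=> [Iher IU Ifin _] [F Fcl IF].
pose K n A := exists2 m, (m <= n)%N &
  exists2 b, F m b & forall i, char_seq A i -> b i.
have KI n A : K n A -> I A.
  move=> [m _ [b Fb Ab]]; apply: (Iher _ [set i | b i]).
    by move=> i Ai; apply: Ab; apply/asboolP.
  have : (\bigcup_n F n) b by exists m.
  by rewrite -IF.
have Kher n : hereditary (K n).
  move=> A B AB [m mn [b Fb Bb]]; exists m => //; exists b => // i.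
  by move=> /asboolP/AB Bi; apply: Bb; apply/asboolP.
have Kcl n : closed (in_cantor (K n)).
  have -> : in_cantor (K n) = \bigcup_(m in `I_n.+1)
      [set c : cantor_space | exists2 b, F m b & forall i, c i -> b i].
    apply/seteqP; split=> c.
      move=> [m mn [b Fb cb]]; exists m; first by [].
      by exists b => // i ci; apply: cb; apply/asboolP.
    move=> [m mn [b Fb cb]]; exists m; first by [].
    by exists b => // i /asboolP/cb.
  by apply: closed_bigcup => [|m _]; [exact: finite_II|exact: closed_downward].
exists (fun=> [set A | forall m, A m -> K m A]).
  move=> _; split; first by move=> A B AB BK m /AB /BK; exact: Kher.
  apply/cantor_compact_closed.
  have -> : in_cantor [set A | forall m, A m -> K m A] =
      \bigcap_m (~` [set b : cantor_space | b m] `|` in_cantor (K m)).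
    apply/seteqP; split=> b bK m.
      by move=> _; have [/bK|/negP] := boolP (b m); [right|left].
    by move=> bm; have [] := bK m Logic.I.
  apply: closed_bigI => m _; apply: closedU; last exact: Kcl.
  by have [/open_closedC] := cantor_clopen_coordinate m.
apply/seteqP; split=> [A IA _ _|A /(_ 0%N Logic.I)[n _ /= AK]].
  have : in_cantor I (char_seq A) by rewrite /in_cantor /= char_seqK.
  rewrite IF => -[n _ FA]; exists n => // m [Am /negP/=]; rewrite -leqNgt => nm.
  exists n => //; exists (char_seq A) => // i /asboolP[Ai _]; exact/asboolP.
apply: (Iher _ (`I_n `|` (A `\` `I_n))).
  by move=> i Ai; have [|] := pselect (`I_n i); [left|right].
apply: IU; first exact/Ifin/finite_II.
have [A0|/set0P[m Am]] := eqVneq (A `\` `I_n) set0; last first.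
  exact: KI (AK m Am).
by rewrite A0; apply: Ifin; exact: finite_set0.
Qed.

(** * Analytic P-ideals are Farah ideals *)

Definition almost_sub (A B : set nat) : Prop :=
  exists n, forall i, (n <= i)%N -> A i -> B i.

Lemma almost_sub_trans (B A C : set nat) :
  almost_sub A B -> almost_sub B C -> almost_sub A C.
Proof.
move=> [m AB] [n BC]; exists (maxn m n) => i; rewrite geq_max => /andP[mi ni].
by move=> /(AB _ mi); exact: BC.
Qed.

Lemma sub_almost_sub (A B : set nat) : A `<=` B -> almost_sub A B.
Proof. by move=> AB; exists 0%N => i _; exact: AB. Qed.

Lemma finite_setD_almost_sub (A B : set nat) :
  finite_set (A `\` B) -> almost_sub A B.
Proof.
move=> /finite_seqP[s sE]; exists (\max_(i <- s) i).+1 => i si Ai.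
apply: contrapT => nBi; have : (A `\` B) i by [].
rewrite sE => is_; move: si; rewrite ltnNge => /negP; apply.
exact: (@leq_bigmax_seq _ s predT id i).
Qed.

Section chain_limit.
Variable s : nat -> seq nat.
Hypothesis s_extends : forall i, (size (s i) < size (s i.+1))%N /\
  take (size (s i)) (s i.+1) = s i.

Lemma chain_limit : exists x : Baire_space, forall i, mkseq x (size (s i)) = s i.
Proof.
have szi i : (i <= size (s i))%N.
  by elim: i => // i IH; apply: leq_ltn_trans IH (proj1 (s_extends i)).
have szW i j : (i <= j)%N -> (size (s i) <= size (s j))%N.
  apply: (homo_leq (f := fun i => size (s i)) (r := leq)) => // [a b c|k].
    exact: leq_trans.
  exact/ltnW/(proj1 (s_extends k)).
have nthE i j k : (i <= j)%N -> (k < size (s i))%N ->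
    nth 0%N (s j) k = nth 0%N (s i) k.
  move=> + ki; elim: j => [|j IH]; first by rewrite leqn0 => /eqP ->.
  rewrite leq_eqVlt => /predU1P[->//|ij]; rewrite -IH//.
  have [_ E] := s_extends j; rewrite -[in RHS]E nth_take//.
  by apply: leq_trans ki _; exact: szW.
exists (fun k => nth 0%N (s k.+1) k) => i.
apply: (@eq_from_nth _ 0%N); rewrite size_mkseq// => k ki; rewrite nth_mkseq//.
have [ik|ki'] := leqP i k.+1; first exact: nthE.
by rewrite (nthE k.+1 i)// ltnW.
Qed.
End chain_limit.

Section analytic_P_ideal.
Variables (I : set (set nat)) (f : Baire_space -> cantor_space).
Hypotheses (I_ideal : is_ideal I) (I_P : P_ideal I).
Hypotheses (f_continuous : continuous f) (f_range : in_cantor I = range f).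

Let p (x : Baire_space) : set nat := [set n | f x n].

Let passes (s : seq nat) (x : Baire_space) : Prop := mkseq x (size s) = s.

Let Ip x : I (p x).
Proof. by have : in_cantor I (f x) by rewrite f_range; exists x. Qed.

Let p_onto A : I A -> exists x, p x = A.
Proof.
move=> IA; have : in_cantor I (char_seq A) by rewrite /in_cantor /= char_seqK.
by rewrite f_range => -[x _ fx]; exists x; rewrite /p fx char_seqK.
Qed.

(** [s] is good when the sets coded by the extensions of [s] are cofinal in [I]
    under almost inclusion. *)
Let good (s : seq nat) : Prop :=
  forall A, I A -> exists2 x, passes s x & almost_sub A (p x).

Let all_good (x : Baire_space) : Prop := forall k, good (mkseq x k).

Let good_nil : good [::].
Proof.
by move=> A /p_onto[x <-]; exists x => //; exact: sub_almost_sub.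
Qed.

(** Here the P-property is used: it gives one [D] in [I] that almost contains,
    for each of the countably many bad [t], a set almost contained in no set
    coded by an extension of [t]. A code whose set almost contains [D] then has
    only good prefixes. *)
Let good_branch s A : good s -> I A ->
  exists x, [/\ passes s x, all_good x & almost_sub A (p x)].
Proof.
move=> gs IA.
have /choice[W WP] : forall t : seq nat, exists W, I W /\
    (~ good t -> forall x, passes t x -> ~ almost_sub W (p x)).
  move=> t; have [gt|/existsNP[W /not_implyP[IW nW]]] := pselect (good t).
    by exists A.
  by exists W; split => // _ x tx Wx; apply: nW; exists x.
have [D ID DP] : exists2 D, I D & forall t, almost_sub (W t) D.
  have [n|D ID DP] := @I_P (fun n => W (odflt [::] (unpickle n))).
    by have [] := WP (odflt [::] (unpickle n)).
  exists D => // t; have := DP (pickle t); rewrite pickleK.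
  exact: finite_setD_almost_sub.
have [x sx ADx] := gs _ (ideal_setU I_ideal IA ID).
exists x; split => // [k|]; last first.
  by apply: almost_sub_trans ADx; apply: sub_almost_sub; exact: subsetUl.
apply: contrapT => ng; have [_ /(_ ng x)] := WP (mkseq x k); apply.
  by rewrite /passes size_mkseq.
apply: almost_sub_trans (DP _) _; apply: almost_sub_trans ADx.
by apply: sub_almost_sub; exact: subsetUr.
Qed.

(** The compact families: for good [s], the closure of the downward closure of the sets coded
    by the extensions of [s] with good prefixes, written out on
    initial segments. *)
Let C (s : seq nat) : set (set nat) := [set B | good s -> forall m, exists x,
  [/\ passes s x, all_good x & forall i, (i < m)%N -> B i -> p x i]].

Let C_hereditary s : hereditary (C s).
Proof.
move=> A B AB CB /CB H m; have [x [sx gx Bx]] := H m; exists x; split=> // i im.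
by move=> /AB; exact: Bx.
Qed.

Let C_compact s : compact (in_cantor (C s)).
Proof.
apply/cantor_compact_closed/closed_agree => b bC gs m.
have [c cC bc] := bC m; have [x [sx gx cx]] := cC gs m.
by exists x; split=> // i im /= bi; apply: cx => //=; rewrite -bc.
Qed.

(** One move of the construction below: extend [s] so far that [B] is covered
    between [N s] and the prescribed [m] by the set of any code extending it. *)
Let C_step B (N : seq nat -> nat) s m : (forall t, C t (B `\` `I_(N t))) ->
  good s -> exists t, [/\ good t, (size s < size t)%N /\ take (size s) t = s &
    forall y, passes t y -> forall i, B i -> (N s <= i < m)%N -> p y i].
Proof.
move=> BC gs; have [x [sx gx Bx]] := BC s gs m.
have [k kx] := baire_modulus x m f_continuous.
pose l := maxn k (size s).+1.
exists (mkseq x l); split; first exact: gx.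
  rewrite size_mkseq leq_maxr; split => //.
  by rewrite /mkseq -map_take take_iota (minn_idPl _)// ltnW// leq_maxr.
move=> y ly i Bi /andP[Ni im].
have xy : agree k x y.
  have : mkseq x l = mkseq y l by move: ly; rewrite /passes size_mkseq.
  by move=> /agree_mkseq; apply: agreeW; exact: leq_maxl.
rewrite /p /= -(kx y xy)//; apply: Bx => //; split => //=.
by apply/negP; rewrite -leqNgt.
Qed.

(** A single code may fail to cover [B]: the bound [N t] from which [B] is controlled
    by an extension [t] of [s] is known only after the point [m] up to which
    [s] has to cover has been chosen. Two codes [x] and [y] built alternately do:
    with prefixes [s_i] and [t_i], the choice of [s_i.+1] makes [x] cover [B]
    on the interval from [N s_i] to [N t_i], and then that of [t_i.+1] makes [y]
    cover it on the interval from [N t_i] to [N s_i.+1]. *)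
Let C_sub B : (forall s, exists n, C s (B `\` `I_n)) -> I B.
Proof.
move=> BC0.
(* The bound by the size makes [N] tend to infinity along both branches. *)
have /choice[N NP] : forall s, exists n, C s (B `\` `I_n) /\ (size s <= n)%N.
  move=> s; have [n Cn] := BC0 s; exists (maxn n (size s)).
  split; last exact: leq_maxr.
  apply: C_hereditary Cn => i [Bi /= ni]; split=> //= ni'; apply: ni.
  by rewrite leq_max ni'.
have BC s : C s (B `\` `I_(N s)) by have [] := NP s.
have /choice[nx nxP] : forall sm : seq nat * nat, exists t, good sm.1 ->
    [/\ good t, (size sm.1 < size t)%N /\ take (size sm.1) t = sm.1 &
    forall y, passes t y -> forall i, B i -> (N sm.1 <= i < sm.2)%N -> p y i].
  move=> [s m] /=; have [gs|ng] := pselect (good s); last by exists [::].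
  by have [t tP] := C_step m BC gs; exists t.
pose next (st : seq nat * seq nat) :=
  let s' := nx (st.1, N st.2) in (s', nx (st.2, N s')).
pose st i := iter i next ([::], [::]).
have gst i : good (st i).1 /\ good (st i).2.
  elim: i => [|i [g1 g2]] //=.
  have [? _ _] := nxP (_, N (st i).2) g1.
  by have [? _ _] := nxP (_, N (st i.+1).1) g2.
have [x xP] := @chain_limit (fun i => (st i).1)
  (fun i => let: And3 _ e _ := nxP (_, N (st i).2) (proj1 (gst i)) in e).
have [y yP] := @chain_limit (fun i => (st i).2)
  (fun i => let: And3 _ e _ := nxP (_, N (st i.+1).1) (proj2 (gst i)) in e).
have Nge i : (i <= N (st i).1)%N.
  apply: leq_trans (proj2 (NP _)); elim: i => // i IH; apply: leq_ltn_trans IH _.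
  by have [_ []] := nxP (_, N (st i).2) (proj1 (gst i)).
have cover n : B n -> (N [::] <= n)%N -> p x n \/ p y n.
  move=> Bn Nn; have exn : exists i, (n < N (st i).1)%N by exists n.+1; exact: Nge.
  case: (ex_minnP exn) => -[|i] ni imin.
    by move: Nn; rewrite leqNgt ni.
  have Nin : (N (st i).1 <= n)%N.
    by rewrite leqNgt; apply/negP => /imin; rewrite ltnn.
  have [nt|tn] := ltnP n (N (st i).2); [left|right].
    have [_ _] := nxP (_, N (st i).2) (proj1 (gst i)).
    by apply=> //; [exact: (xP i.+1)|rewrite /= Nin].
  have [_ _] := nxP (_, N (st i.+1).1) (proj2 (gst i)).
  by apply=> //; [exact: (yP i.+1)|rewrite /= tn].
apply: (ideal_hereditary I_ideal (B := `I_(N [::]) `|` (p x `|` p y))).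
  move=> n Bn; have [nN|Nn] := ltnP n (N [::]); first by left.
  by right; have [] := cover n Bn Nn; [left|right].
apply: ideal_setU => //; first by apply: ideal_finite => //; exact: finite_II.
exact: ideal_setU.
Qed.

(** Members of [I] have a final segment in each [C s], by cofinality; [C_sub] is
    the converse. *)
Lemma range_P_ideal_Farah : Farah I.
Proof.
exists (fun i => C (odflt [::] (unpickle i))).
  by move=> i; split; [exact: C_hereditary|exact: C_compact].
apply/seteqP; split=> [A IA i _|B BC].
  have [gs|ng] := pselect (good (odflt [::] (unpickle i))); last first.
    by exists 0%N.
  have [x [sx gx [n nx]]] := good_branch gs IA.
  exists n => // _ m; exists x; split=> // j _ [Aj /negP/=]; rewrite -leqNgt => nj.
  exact: nx.
apply: C_sub => s; have [n _] := BC (pickle s) Logic.I.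
by rewrite pickleK; exists n.
Qed.

End analytic_P_ideal.

Lemma analytic_P_ideal_Farah (I : set (set nat)) : is_ideal I ->
  analytic (in_cantor I) -> P_ideal I -> Farah I.
Proof.
move=> I_ideal /(analytic_ideal_range I_ideal)[f cf fI] IP.
exact: range_P_ideal_Farah cf fI.
Qed.

(** * The subgroups of the circle *)

Section characterized_subgroups.
Local Open Scope ring_scope.
Variables (R : realType) (a : nat -> int) (I : set (set nat)).
Hypothesis I_ideal : is_ideal I.

Let g (n : nat) (x : circle R) : R := circle_norm (x *~ a n).

Let g_continuous n : continuous (g n).
Proof. exact: circle_norm_mul_continuous. Qed.

Let gB n x y : g n (x - y) <= g n x + g n y.
Proof.
rewrite /g mulrzBl; apply: le_trans (circle_normD _ _) _.
by rewrite circle_normN.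
Qed.

Let g0 n : g n 0 = 0. Proof. by rewrite /g mul0rz circle_norm0. Qed.

Lemma HsetP x : Hset R a I x <-> forall e : R, 0 < e -> I [set n | e <= g n x].
Proof.
have E e : [set n | e <= g n x] = [set n | e <= circle_norm (x *~ a n - 0)].
  by apply/seteqP; split=> n /=; rewrite subr0.
by split=> H e /H; rewrite E.
Qed.

Lemma Hset_invP x : Hset R a I x <-> forall k, I [set n | k.+1%:R^-1 <= g n x].
Proof.
rewrite HsetP; split=> H => [k|e e0]; first by apply: H.
have [k] := ltr_add_invr e0; rewrite add0r => ke.
by apply: (ideal_hereditary I_ideal _ (H k)) => n /=; apply: le_trans; exact: ltW.
Qed.

Lemma Hset_bigcap_level :
  Hset R a I = \bigcap_k (level g k.+1%:R^-1 @^-1` in_cantor I).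
Proof.
apply/seteqP; split=> x; first by move=> /Hset_invP H k _; exact: H.
by move=> H; apply/Hset_invP => k; exact: H.
Qed.

Lemma Hset_subgroup : subgroup (Hset R a I).
Proof.
split; rewrite ?inE; last first.
  move=> x y; rewrite !inE => /HsetP Hx /HsetP Hy; apply/HsetP => e e0.
  have e20 : 0 < e / 2 by rewrite divr_gt0.
  apply: (ideal_hereditary I_ideal _ (ideal_setU I_ideal (Hx _ e20) (Hy _ e20))).
  move=> n /= en; have [xl|xl] := leP (e / 2) (g n x); [by left|right].
  by move: (gB n x y) => /=; lra.
apply/HsetP => e e0; apply: (ideal_hereditary I_ideal _
  (ideal_finite I_ideal (finite_set0 nat))).
by move=> n /=; rewrite g0 leNgt e0.
Qed.

Lemma Hset_Pi0 alpha : Pi0 alpha (in_cantor I) ->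
  Pi0 (omega1_succ alpha) (Hset R a I).
Proof.
move=> IP; rewrite /Pi0 Hset_bigcap_level setC_bigcap.
apply: Sigma0_bigcup_nat => k; rewrite preimage_setC.
apply: Sigma0_preimage IP => U; exact: level_preimage_open.
Qed.

Lemma Hset_Sigma0 alpha : (omega1_one <= alpha)%O ->
  Sigma0 alpha (in_cantor I) ->
  Pi0 (omega1_succ (omega1_succ alpha)) (Hset R a I).
Proof.
move=> a1 IS; rewrite /Pi0 Hset_bigcap_level setC_bigcap.
apply: (@Sigma0_bigcup _ _ (fun=> omega1_succ alpha)).
- by apply: lt_trans (omega1_lt_succ _); apply: le_lt_trans a1 (omega1_lt_succ _).
- by move=> _; rewrite omega1_lt_succ (le_trans a1)// ltW// omega1_lt_succ.
- move=> k; rewrite setCK.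
  by apply: Sigma0_preimage IS => U; exact: level_preimage_open.
Qed.

Lemma Hset_Borel : Borel (in_cantor I) -> Borel (Hset R a I).
Proof.
move=> IB; rewrite Hset_bigcap_level; apply: Borel_bigcap => k.
by apply: Borel_preimage IB => U; exact: level_preimage_open.
Qed.

(** If [x] is a limit of points [y] of the set, then each finite part of the
    strict level set of [x] is contained in that of some such [y], because strict
    inequalities are open conditions. Heredity puts these finite parts in [C],
    and closedness puts their union there. *)
Lemma closed_hereditary_level (C : set (set nat)) (e : R) (m : nat) :
  hereditary C -> closed (in_cantor C) ->
  closed [set x | C ([set n | e < g n x] `\` `I_m)].
Proof.
move=> Cher /closed_agree Ccl x xcl.
suff : in_cantor C (char_seq ([set n | e < g n x] `\` `I_m)).
  by rewrite /in_cantor /= char_seqK.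
apply: Ccl => k.
have : nbhs x [set y | forall n, (n < k)%N -> e < g n x -> e < g n y].
  elim: k => [|k IHk]; first exact: filterE.
  have : nbhs x [set y | e < g k x -> e < g k y].
    have [_|ex] := leP (g k x) e; first by apply: filterE => y.
    have h : nbhs x (g k @^-1` [set r | e < r]).
      by apply: g_continuous; exact: lt_nbhsr.
    by apply: filterS h => y ey _.
  move=> h; apply: filterS (filterI IHk h) => y [yk yk'] n.
  by rewrite ltnS leq_eqVlt => /predU1P[->|]; [exact: yk'|exact: yk].
move=> /xcl[y [Cy xy]].
exists (char_seq (([set n | e < g n x] `\` `I_m) `&` `I_k)).
  rewrite /in_cantor /= char_seqK; apply: Cher Cy => n [[/= en nm] nk].
  by split => //=; exact: xy.
move=> i ik; rewrite /char_seq; congr (`[< _ >]); apply/propext.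
by split=> [|[]].
Qed.

(** Strict level sets may replace level sets at the cost of a smaller threshold;
    they turn each compact family of the Farah property into a closed set of
    points of the circle. *)
Lemma Hset_Farah : Farah I -> Fsigmadelta (Hset R a I).
Proof.
move=> [C CP IE].
pose F (ki : nat * nat) : set (circle R) := \bigcup_m
  [set x | C ki.2 ([set n | ki.1.+1%:R^-1 < g n x] `\` `I_m)].
have Fcl ki : Fsigma (F ki).
  exists (fun m =>
    [set x | C ki.2 ([set n | ki.1.+1%:R^-1 < g n x] `\` `I_m)]) => // m.
  have [Ch /cantor_compact_closed Cc] := CP ki.2.
  exact: closed_hereditary_level.
exists (fun n => F (odflt (0%N, 0%N) (unpickle n))) => //.
have -> : \bigcap_n F (odflt (0%N, 0%N) (unpickle n)) = \bigcap_ki F ki.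
  apply/seteqP; split=> x xF => [ki|n] _; last exact: xF.
  by have := xF (pickle ki) Logic.I; rewrite pickleK.
apply/seteqP; split=> x.
  move=> /Hset_invP xH [k i] _; have := xH k; rewrite [in X in X -> _]IE.
  move=> /(_ i Logic.I)[m _ Cm]; exists m => //; have [Ch _] := CP i.
  by apply: Ch Cm => n [/ltW ? ?].
move=> xF; apply/HsetP => e e0; have [k] := ltr_add_invr e0; rewrite add0r => ke.
apply: (ideal_hereditary I_ideal (B := [set n | k.+1%:R^-1 < g n x])).
  by move=> n /=; exact: lt_le_trans.
by rewrite IE => i _; have [m _ Cm] := xF (k, i) Logic.I; exists m.
Qed.

(** The rows of a code after the first are left for witnesses. *)
Let point (z : Baire_space) : circle R := circle_of_baire R (row_of z 0).

Let point_continuous : continuous point.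
Proof.
move=> z; apply: (@continuous_comp _ _ _ (row_of^~ 0%N) (@circle_of_baire R)).
  exact: row_of_continuous.
exact: circle_of_baire_continuous.
Qed.

Let g_point_continuous n : continuous (g n \o point).
Proof.
by move=> z; apply: continuous_comp; [exact: point_continuous|exact: g_continuous].
Qed.

Let closed_g_le n e : closed [set z | g n (point z) <= e].
Proof. exact: (closed_level_le (g := fun n => g n \o point)). Qed.

Let closed_g_ge n e : closed [set z | e <= g n (point z)].
Proof. exact: (closed_level_ge (g := fun n => g n \o point)). Qed.

Let clopen_row (i n : nat) (P : set nat) : clopen [set z | P (row_of z i n)].
Proof. exact: (@clopen_coordinate nat (pickle (i, n)) P). Qed.

Let clopen_image (f : Baire_space -> cantor_space) (i n : nat) :
  continuous f -> clopen [set z | f (row_of z i) n].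
Proof.
move=> cf; have cfr : continuous (fun z => f (row_of z i)).
  move=> z; apply: (@continuous_comp _ _ _ (row_of^~ i) f).
    exact: row_of_continuous.
  exact: cf.
exact: (preimage_clopen (cantor_clopen_coordinate n) cfr).
Qed.

(** By heredity, [x] is in the set iff for every [k] there is some [B] in [I]
    such that [circle_norm (x *~ a n) <= k.+1%:R^-1] for all [n] outside [B],
    which is a closed condition on [x] and the codes of the sets [B]: row [k.+1]
    codes the set for [k]. *)
Lemma Hset_analytic : analytic (in_cantor I) -> analytic (Hset R a I).
Proof.
move=> /(analytic_ideal_range I_ideal)[f cf fI].
pose D : set Baire_space := \bigcap_kn ([set z | f (row_of z kn.1.+1) kn.2] `|`
  [set z | g kn.2 (point z) <= kn.1.+1%:R^-1]).
have -> : Hset R a I = point @` D.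
  apply/seteqP; split=> x.
    move=> /Hset_invP xH.
    have /choice[y yP] : forall k, exists y,
        f y = char_seq [set n | k.+1%:R^-1 <= g n x].
      move=> k; have : in_cantor I (char_seq [set n | k.+1%:R^-1 <= g n x]).
        by rewrite /in_cantor /= char_seqK.
      by rewrite fI => -[y _ yE]; exists y.
    have [u ux] := circle_of_baire_surj x.
    pose z := of_rows (fun i => if i is k.+1 then y k else u).
    have zx : point z = x by rewrite /point of_rowsK.
    exists z => // -[k n] _ /=; rewrite zx of_rowsK yP.
    by have [h|/ltW h] := leP (k.+1%:R^-1) (g n x); [left; exact/asboolP|right].
  move=> [z Dz <-]; apply/HsetP => e e0; have [k] := ltr_add_invr e0; rewrite add0r => ke.
  have : in_cantor I (f (row_of z k.+1)) by rewrite fI; exists (row_of z k.+1).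
  apply: (ideal_hereditary I_ideal) => n /= en.
  have [//|/=] := Dz (k, n) Logic.I.
  by move=> gk; have := le_lt_trans gk ke; rewrite ltNge en.
apply: analytic_image_closed; last exact: point_continuous.
apply: closed_bigI => -[k n] _; apply: closedU; last exact: closed_g_le.
by have [] := clopen_image k.+1 n cf.
Qed.

(** Dually, [x] is outside the set iff for some [k] there is some [B] outside [I]
    such that [k.+1%:R^-1 <= circle_norm (x *~ a n)] for all [n] in [B]. Row 1
    codes [B] and the first term of row 2 is [k]. *)
Lemma Hset_coanalytic : coanalytic (in_cantor I) -> coanalytic (Hset R a I).
Proof.
move=> [I0|[f cf fI]].
  have : (~` in_cantor I) (char_seq setT).
    by rewrite /in_cantor /= char_seqK; exact: ideal_setT.
  by rewrite I0.
pose D : set Baire_space := \bigcap_kn (~` [set z | row_of z 2 0 = kn.1] `|`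
  (~` [set z | f (row_of z 1) kn.2] `|`
  [set z | kn.1.+1%:R^-1 <= g kn.2 (point z)])).
rewrite /coanalytic; have -> : ~` Hset R a I = point @` D.
  apply/seteqP; split=> x.
    move=> /= /(contra_not (proj2 (Hset_invP x)))/existsNP[k nI].
    have : (~` in_cantor I) (char_seq [set n | k.+1%:R^-1 <= g n x]).
      by rewrite /in_cantor /= char_seqK.
    rewrite fI => -[y _ yE]; have [u ux] := circle_of_baire_surj x.
    pose z := of_rows
      (fun i => if i is i.+1 then if i is _.+1 then fun=> k else y else u).
    have zx : point z = x by rewrite /point of_rowsK.
    exists z => // -[l n] _ /=; rewrite zx !of_rowsK yE.
    have [<-|nkl] := eqVneq k l; last by left; apply/eqP.
    right; have [h|h] := leP (k.+1%:R^-1) (g n x); first by right.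
    by left; move=> /asboolP /=; rewrite leNgt h.
  move=> [z Dz <-] /Hset_invP/(_ (row_of z 2 0)) zI.
  have : (~` in_cantor I) (f (row_of z 1)) by rewrite fI; exists (row_of z 1).
  apply; apply: (ideal_hereditary I_ideal _ zI) => n /= fn.
  by have [/(_ erefl)|[/(_ fn)|]] := Dz (row_of z 2 0%N, n) Logic.I.
apply: analytic_image_closed; last exact: point_continuous.
apply: closed_bigI => -[k n] _; apply: closedU.
  by have [/open_closedC] := clopen_row 2 0 [set k].
apply: closedU; last exact: closed_g_ge.
by have [/open_closedC] := clopen_image 1 n cf.
Qed.

Lemma Hset_starP x : Hset_star R a I x <-> exists2 S, I S &
  forall k, exists m, forall n, (m <= n)%N -> S n \/ g n x <= k.+1%:R^-1.
Proof.
split=> -[S IS xS]; exists S => //.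
  move=> k; have : nbhs (0 : circle R) [set y | circle_norm y <= k.+1%:R^-1].
    by apply/nbhs_circle0; exists k.+1%:R^-1 => // y /ltW.
  move=> /xS [m _ mS]; exists m => n mn.
  by have [|nSn] := pselect (S n); [left|right; exact: mS].
move=> U /nbhs_circle0[e e0 eU]; have [k] := ltr_add_invr e0; rewrite add0r => ke.
have [m mS] := xS k; exists m => // n mn nSn; apply: eU.
by have [|h] := mS n mn; [|exact: le_lt_trans ke].
Qed.

Lemma Hset_star_subgroup : subgroup (Hset_star R a I).
Proof.
split; rewrite ?inE; last first.
  move=> x y; rewrite !inE => /Hset_starP[S IS xS] /Hset_starP[S' IS' yS].
  apply/Hset_starP; exists (S `|` S'); first exact: ideal_setU.
  move=> k; have [m mS] := xS (k.*2.+1); have [m' mS'] := yS (k.*2.+1).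
  exists (maxn m m') => n; rewrite geq_max => /andP[mn mn'].
  have [|gx] := mS n mn; first by left; left.
  have [|gy] := mS' n mn'; first by left; right.
  right; apply: le_trans (gB n x y) _; apply: le_trans (lerD gx gy) _.
  have -> : k.*2.+2%:R = 2 * k.+1%:R :> R by rewrite -natrM mul2n doubleS.
  rewrite invfM -mulrDl -[2^-1 + _]/(2^-1 *+ 2) -[2^-1 *+ 2]mulr_natl.
  by rewrite divff ?mul1r.
apply/Hset_starP; exists set0; first by apply: ideal_finite => //; exact: finite_set0.
by move=> k; exists 0%N => n _; right; rewrite g0.
Qed.

(** Row 1 codes the exceptional set and row 2 is a modulus of convergence. *)
Lemma Hset_star_analytic : analytic (in_cantor I) -> analytic (Hset_star R a I).
Proof.
move=> /(analytic_ideal_range I_ideal)[f cf fI].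
pose D : set Baire_space := \bigcap_kn ([set z | (kn.2 < row_of z 2 kn.1)%N] `|`
  ([set z | f (row_of z 1) kn.2] `|`
  [set z | g kn.2 (point z) <= kn.1.+1%:R^-1])).
have -> : Hset_star R a I = point @` D.
  apply/seteqP; split=> x.
    move=> /Hset_starP[S IS /choice[m mP]].
    have : in_cantor I (char_seq S) by rewrite /in_cantor /= char_seqK.
    rewrite fI => -[y _ yE]; have [u ux] := circle_of_baire_surj x.
    pose z := of_rows
      (fun i => if i is i.+1 then if i is _.+1 then m else y else u).
    have zx : point z = x by rewrite /point of_rowsK.
    exists z => // -[k n] _ /=; rewrite zx !of_rowsK yE.
    have [mn|] := leqP (m k) n; last by left.
    by right; have [Sn|gn] := mP k n mn; [left; exact/asboolP|right].
  move=> [z Dz <-]; apply/Hset_starP; exists [set n | f (row_of z 1) n].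
    have : in_cantor I (f (row_of z 1)) by rewrite fI; exists (row_of z 1).
    by [].
  move=> k; exists (row_of z 2 k) => n mn; have [|//] := Dz (k, n) Logic.I.
  by rewrite /= ltnNge mn.
apply: analytic_image_closed; last exact: point_continuous.
apply: closed_bigI => -[k n] _; apply: closedU.
  by have [] := clopen_row 2 k [set m | (n < m)%N].
apply: closedU; last exact: closed_g_le.
by have [] := clopen_image 1 n cf.
Qed.

End characterized_subgroups.

Theorem theorem2p5 (R : realType) (I : set (set nat)) (a : nat -> int)
    (alpha : omega1) (I_ideal : is_ideal I)
    (alpha_ge1 : (omega1_one <= alpha)%O) :
  (* (i) *)
  [/\ Farah I -> Fsigmadelta (Hset R a I) /\ subgroup (Hset R a I),
      Fsigma (in_cantor I) -> Farah I
    & analytic (in_cantor I) -> P_ideal I -> Farah I] /\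
  (* (ii) *)
  (Pi0 alpha (in_cantor I) ->
     Pi0 (omega1_succ alpha) (Hset R a I) /\ subgroup (Hset R a I)) /\
  (* (iii) *)
  (Sigma0 alpha (in_cantor I) ->
     Pi0 (omega1_succ (omega1_succ alpha)) (Hset R a I) /\
     subgroup (Hset R a I)) /\
  (* (iv) *)
  [/\ Borel (in_cantor I) -> Borel (Hset R a I) /\ subgroup (Hset R a I),
      analytic (in_cantor I) -> analytic (Hset R a I) /\ subgroup (Hset R a I)
    & coanalytic (in_cantor I) ->
        coanalytic (Hset R a I) /\ subgroup (Hset R a I)] /\
  (* (v) *)
  (analytic (in_cantor I) ->
     analytic (Hset_star R a I) /\ subgroup (Hset_star R a I)).
Proof.
split; [|split; [|split; [|split]]].
- split; last exact: analytic_P_ideal_Farah; last exact: Fsigma_Farah.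
  by move=> IF; split; [exact: Hset_Farah|exact: Hset_subgroup].
- by move=> IP; split; [exact: Hset_Pi0|exact: Hset_subgroup].
- by move=> IS; split; [exact: Hset_Sigma0|exact: Hset_subgroup].
- split=> h; split; try exact: Hset_subgroup.
  + exact: Hset_Borel.
  + exact: Hset_analytic.
  + exact: Hset_coanalytic.
- by move=> h; split; [exact: Hset_star_analytic|exact: Hset_star_subgroup].
Qed.
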